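(* Let $\mu\in\mathbb{R}^n$ satisfy $\mu_1\ge\mu_2\ge\cdots\ge\mu_n$. Let $\{M_m\}_{m\ge 1}$ be a sequence of real symmetric $n\times n$ matrices converging to $0$ such that $M_m/\|M_m\|$ converges to a matrix $M$. Let $U_m\to U\in O^n$ be a sequence of orthogonal matrices such that $$\mathrm{Diag}\,\mu+M_m=U_m\big(\mathrm{Diag}\,\lambda(\mathrm{Diag}\,\mu+M_m)\big)U_m^T\quad\text{for all } m=1,2,\dots.$$ Then for every ($\mu$-)block-constant $k$-tensor $T$ on $\mathbb{R}^n$, any real $n\times n$ matrices $H_1,\dots,H_k$, and any permutation $\sigma$ on $\mathbb{N}_k$, $$\lim_{m\to\infty}\Big(\frac{U_m(\mathrm{Diag}^{\sigma}T)U_m^T-\mathrm{Diag}^{\sigma}T}{\|M_m\|}\Big)[H_1,\dots,H_k]=\sum_{l=1}^k\big(\mathrm{Diag}^{\sigma_{(l)}}T^{(l)}_{\mathrm{out}}\big)[H_1,\dots,H_k,M_{\mathrm{out}}].$$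
   Context: $\mathbb{N}_k=\{1,\dots,k\}$; $O^n$ is the set of real orthogonal $n\times n$ matrices; $\lambda(A)$ is the vector of eigenvalues of the symmetric matrix $A$ in nonincreasing order; $\mathrm{Diag}\,x$ is the diagonal matrix with $x$ on the diagonal; $\|X\|=\sqrt{\mathrm{tr}(XX^T)}$. The matrix entries are written $H^{ij}$. Convergence of $M_m/\|M_m\|$ presupposes $M_m\ne0$. A $k$-tensor on $\mathbb{R}^n$ is a $k$-linear map $(\mathbb{R}^n)^k\to\mathbb{R}$, identified with its array of components $T^{i_1\dots i_k}$, $i_s\in\mathbb{N}_n$. Equivalence: $i\sim j$ iff $\mu_i=\mu_j$. $T$ is ($\mu$-)block-constant if $T^{i_1\dots i_k}=T^{j_1\dots j_k}$ whenever $i_s\sim j_s$ for all $s$. For a square matrix $H$: $H_{\mathrm{out}}^{ij}=H^{ij}$ if $i\not\sim j$ and $0$ otherwise. For a $k$-tensor $T$ and a permutation $\sigma$ on $\mathbb{N}_k$, $\mathrm{Diag}^{\sigma}T$ is the $2k$-tensor, with indices arranged as $\substack{i_1\dots i_k\\ j_1\dots j_k}$, given by $(\mathrm{Diag}^{\sigma}T)^{\substack{i_1\dots i_k\\ j_1\dots j_k}}=T^{i_1\dots i_k}$ if $i_s=j_{\sigma(s)}$ for all $s=1,\dots,k$, and $0$ otherwise. A $2k$-tensor $S$ acts on $k$ matrices by $S[H_1,\dots,H_k]=\sum_{p,q}S^{\substack{p_1\dots p_k\\ q_1\dots q_k}}H_1^{p_1q_1}\cdots H_k^{p_kq_k}$.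 Conjugation of a $2k$-tensor $S$ by $U\in O^n$: $(USU^T)^{\substack{i_1\dots i_k\\ j_1\dots j_k}}=\sum_{p,q}S^{\substack{p_1\dots p_k\\ q_1\dots q_k}}\prod_{\nu=1}^kU^{i_\nu p_\nu}U^{j_\nu q_\nu}$. For $l\in\mathbb{N}_k$, $T^{(l)}_{\mathrm{out}}$ is the $(k+1)$-tensor $$\big(T^{(l)}_{\mathrm{out}}\big)^{i_1\dots i_ki_{k+1}}=\begin{cases}0,& i_l\sim i_{k+1},\\ \dfrac{T^{i_1\dots i_{l-1}i_{k+1}i_{l+1}\dots i_k}-T^{i_1\dots i_{l-1}i_li_{l+1}\dots i_k}}{\mu_{i_{k+1}}-\mu_{i_l}},& i_l\not\sim i_{k+1}.\end{cases}$$ A permutation $\sigma$ on $\mathbb{N}_k$ is viewed as a permutation on $\mathbb{N}_{k+1}$ fixing $k+1$, and $\sigma_{(l)}=\sigma\circ\tau_l$, where $\tau_l=(l,k+1)$ is the transposition (so $\sigma_{(l)}(l)=k+1$, $\sigma_{(l)}(k+1)=\sigma(l)$ for $l\le k$). *)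

(* Defs.v *)
From HB Require Import structures.
From mathcomp Require Import all_boot all_order all_algebra all_fingroup.
From mathcomp Require Import -(notations) complex.
From mathcomp Require Import all_classical all_reals all_analysis.

Set Implicit Arguments.
Unset Strict Implicit.
Unset Printing Implicit Defensive.

Import Order.TTheory GRing.Theory Num.Theory.
Import numFieldNormedType.Exports.

Local Open Scope classical_set_scope.
Local Open Scope ring_scope.

Definition orthogonal_mx (R : realType) (n : nat) (U : 'M[R]_n) : Prop :=
  U *m U^T = 1%:M.

(* The norm that MathComp-Analysis puts on 'M[R]_n is the max norm, hence this
   separate definition; the topology is the same. *)
Definition fnorm (R : realType) (n : nat) (X : 'M[R]_n) : R :=
  Num.sqrt (\tr (X *m X^T)).

Definition nonincreasing_rv (R : realType) (n : nat) (x : 'rV[R]_n) : Prop :=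
  forall i j : 'I_n, (i <= j)%N -> x ord0 j <= x ord0 i.

(* The characteristic polynomial makes each eigenvalue occur in [x] as often as
   its multiplicity. *)
Definition is_spectrum (R : realType) (n : nat) (A : 'M[R]_n) (x : 'rV[R]_n)
    : Prop :=
  nonincreasing_rv x /\ char_poly A = \prod_(i < n) ('X - (x ord0 i)%:P).

(* The value 0 is only taken when the spectrum of [A] is not real; for symmetric
   [A] see [lambdaP] below, and [is_spectrum_inj] for uniqueness. *)
Definition lambda (R : realType) (n : nat) (A : 'M[R]_n) : 'rV[R]_n :=
  xget 0 [set x | is_spectrum A x].

Definition multi_index (n k : nat) := {ffun 'I_k -> 'I_n}.

Definition tensor (R : realType) (n k : nat) := {ffun multi_index n k -> R}.

(* A 2k-tensor; the pair [(i, j)] is the two-row index with [i] above [j]. *)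
Definition tensor2 (R : realType) (n k : nat) :=
  {ffun multi_index n k * multi_index n k -> R}.

Definition mu_equiv (R : realType) (n : nat) (mu : 'rV[R]_n) (i j : 'I_n)
    : bool :=
  mu ord0 i == mu ord0 j.

Definition block_constant (R : realType) (n k : nat) (mu : 'rV[R]_n)
    (T : tensor R n k) : Prop :=
  forall i j : multi_index n k,
    (forall s : 'I_k, mu_equiv mu (i s) (j s)) -> T i = T j.

Definition mx_out (R : realType) (n : nat) (mu : 'rV[R]_n) (H : 'M[R]_n)
    : 'M[R]_n :=
  \matrix_(i, j) (if mu_equiv mu i j then 0 else H i j).

Definition tdiag (R : realType) (n k : nat) (sigma : 'S_k) (T : tensor R n k)
    : tensor2 R n k :=
  [ffun ij : multi_index n k * multi_index n k => if [forall s : 'I_k, ij.1 s == ij.2 (sigma s)]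
              then T ij.1 else 0].

Definition tapply (R : realType) (n k : nat) (S : tensor2 R n k)
    (H : 'I_k -> 'M[R]_n) : R :=
  \sum_(p : multi_index n k) \sum_(q : multi_index n k)
    S (p, q) * \prod_(s < k) H s (p s) (q s).

Definition tconj (R : realType) (n k : nat) (U : 'M[R]_n) (S : tensor2 R n k)
    : tensor2 R n k :=
  [ffun ij : multi_index n k * multi_index n k => \sum_(p : multi_index n k) \sum_(q : multi_index n k)
     S (p, q) * \prod_(s < k) (U (ij.1 s) (p s) * U (ij.2 s) (q s))].

(* In 'I_k.+1, [ord_max] plays the role of the last position k+1 and
   [lift ord_max s] is [s : 'I_k] seen among the first k positions. *)
Definition mi_init (n k : nat) (i : multi_index n k.+1) : multi_index n k :=
  [ffun s => i (lift ord_max s)].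

Definition mi_set (n k : nat) (i : multi_index n k) (l : 'I_k) (a : 'I_n)
    : multi_index n k :=
  [ffun s => if s == l then a else i s].

Definition tensor_out (R : realType) (n k : nat) (mu : 'rV[R]_n) (l : 'I_k)
    (T : tensor R n k) : tensor R n k.+1 :=
  [ffun i : multi_index n k.+1 =>
     let il := i (lift ord_max l) in
     let ilast := i ord_max in
     if mu_equiv mu il ilast then 0
     else (T (mi_set (mi_init i) l ilast) - T (mi_init i))
          / (mu ord0 ilast - mu ord0 il)].

(* In MathComp, [(s * t)%g x = t (s x)]. *)
Definition perm_ext (k : nat) (sigma : 'S_k) (l : 'I_k) : 'S_k.+1 :=
  (tperm (lift ord_max l) ord_max * lift_perm ord_max ord_max sigma)%g.

Definition mxs_rcons (R : realType) (n k : nat) (H : 'I_k -> 'M[R]_n)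
    (Hlast : 'M[R]_n) : 'I_k.+1 -> 'M[R]_n :=
  fun s => if unlift ord_max s is Some s' then H s' else Hlast.

Lemma perm_ext_l (k : nat) (sigma : 'S_k) (l : 'I_k) :
  perm_ext sigma l (lift ord_max l) = ord_max.
Proof. by rewrite permM tpermL lift_perm_id. Qed.

Lemma perm_ext_max (k : nat) (sigma : 'S_k) (l : 'I_k) :
  perm_ext sigma l ord_max = lift ord_max (sigma l).
Proof. by rewrite permM tpermR lift_perm_lift. Qed.

Lemma perm_ext_neq (k : nat) (sigma : 'S_k) (l s : 'I_k) : s != l ->
  perm_ext sigma l (lift ord_max s) = lift ord_max (sigma s).
Proof.
move=> sl; rewrite permM tpermD ?lift_perm_lift ?neq_lift //.
by apply: contraNneq sl => /lift_inj ->.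
Qed.

Lemma is_spectrum_sorted (R : realType) (n : nat) (A : 'M[R]_n)
    (x : 'rV[R]_n) :
  is_spectrum A x -> sorted >=%R [seq x ord0 i | i <- enum 'I_n].
Proof.
case: n A x => [|n] A x [xs _].
  by rewrite (size0nil (size_enum_ord 0)).
apply/(sortedP 0) => i; rewrite size_map size_enum_ord => ltin.
rewrite !(nth_map ord0) -?enumT ?size_enum_ord ?(ltnW ltin) //.
by apply: xs; rewrite !nth_enum_ord ?(ltnW ltin).
Qed.

Lemma is_spectrum_inj (R : realType) (n : nat) (A : 'M[R]_n)
    (x y : 'rV[R]_n) :
  is_spectrum A x -> is_spectrum A y -> x = y.
Proof.
move=> xA yA.
suff E : [seq x ord0 i | i <- enum 'I_n] = [seq y ord0 i | i <- enum 'I_n].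
  by apply/rowP => i; move/eq_in_map: E; apply; rewrite mem_enum.
apply: (@sorted_eq _ >=%R); [exact: ge_trans|exact: ge_anti| | |].
- exact: is_spectrum_sorted xA.
- exact: is_spectrum_sorted yA.
apply: prod_XsubC_eq; rewrite !big_map -!enumT !big_enum /=.
by rewrite -(proj2 xA) -(proj2 yA).
Qed.

Lemma is_spectrum_exists (R : realType) (n : nat) (A : 'M[R]_n)
    (d : 'rV[R]_n) :
  char_poly A = \prod_(i < n) ('X - (d ord0 i)%:P) ->
  exists x, is_spectrum A x.
Proof.
move=> dA; pose s := sort >=%R [seq d ord0 i | i <- enum 'I_n].
have ss : size s = n by rewrite size_sort size_map size_enum_ord.
exists (\row_i nth 0 s i); split.
  move=> i j ij; rewrite !mxE.
  have := sort_sorted (@ge_total _ R) [seq d ord0 i | i <- enum 'I_n].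
  move/(sorted_leq_nth ge_trans ge_refl) => srt.
  by apply: (srt 0 i j); rewrite // inE -/s ss.
under eq_bigr do rewrite mxE.
rewrite dA -(big_mkord xpredT (fun i => 'X - (nth 0 s i)%:P)) -[X in index_iota 0 X]ss.
rewrite -(big_nth 0 xpredT (fun a => 'X - a%:P)).
rewrite (perm_big [seq d ord0 i | i <- enum 'I_n]) ?big_map -?enumT ?big_enum //.
by rewrite perm_sort.
Qed.

Lemma lambdaP (R : realType) (n : nat) (A : 'M[R]_n) :
  A^T = A -> is_spectrum A (lambda A).
Proof.
move=> Asym; suff [x xA] : exists x, is_spectrum A x.
  by rewrite /lambda; case: xgetP => [y -> //|/(_ x)].
pose f : {rmorphism R -> complex R} := @real_complex_def R (Phant R).
pose B : 'M[complex R]_n := map_mx f A.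
have Bh : B \is hermsymmx.
  apply/realsym_hermsym.
    by apply/is_hermitianmxP; rewrite expr0 scale1r map_mx_id // map_trmx Asym.
  apply/mxOverP => i j; rewrite mxE.
  by rewrite complex_real.
pose P := spectralmx B; pose d := spectral_diag B.
have Pu : P \in unitmx := spectral_unit B.
have BE : B = invmx P *m diag_mx d *m P.
  exact/orthomx_spectralP/hermitian_normalmx.
have dR i : f (complex.Re (d ord0 i)) = d ord0 i.
  apply: RRe_real; exact: (mxOverP (hermitian_spectral_diag_real Bh)).
apply: (@is_spectrum_exists _ _ _ (\row_i complex.Re (d ord0 i))).
apply: (map_poly_inj f); rewrite map_char_poly -/B rmorph_prod /=.
under eq_bigr do rewrite mxE rmorphB /= map_polyX map_polyC /= dR.
have -> : char_poly B = char_poly (diag_mx d).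
  rewrite /char_poly /char_poly_mx.
  pose Q := map_mx polyC P; pose Q' := map_mx polyC (invmx P).
  have Q'Q : Q' *m Q = 1%:M by rewrite -map_mxM mulVmx // map_mx1.
  have -> : 'X%:M - map_mx polyC B
      = Q' *m ('X%:M - map_mx polyC (diag_mx d)) *m Q.
    rewrite mulmxBr mulmxBl {1}BE !map_mxM; congr (_ - _).
    by rewrite scalar_mxC -mulmxA Q'Q mulmx1.
  by rewrite !det_mulmx mulrAC -det_mulmx Q'Q det1 mul1r.
rewrite char_poly_trig ?diag_mx_is_trig //.
by apply: eq_bigr => i _; rewrite mxE eqxx mulr1n.
Qed.

(* Main.v *)
(* Put [c_m = 1 / |M_m|]. Since [lambda (Diag mu + M_m)] tends to [mu], the limit
   [U] commutes with [Diag mu], and the eigenvector equation determines the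
   entries of [c_m U_m] off the blocks of [mu] in the limit. Hence, for a vector
   [f] constant on blocks, [c_m (U_m (Diag f) U_m^T - Diag f)] tends to the matrix
   with entries [(f_i - f_j) M_out^ij / (mu_i - mu_j)].
   A block-constant tensor is a combination of tensor products of such vectors
   [f], for which conjugation by [U_m] gives a product of entries of
   [U_m (Diag f) U_m^T]; the limit is then given by the product rule. *)
Require Import Defs.
From HB Require Import structures.
From mathcomp Require Import all_boot all_order all_algebra all_fingroup.
From mathcomp Require Import all_classical all_reals all_analysis.
From mathcomp Require Import ring.

Set Implicit Arguments.
Unset Strict Implicit.
Unset Printing Implicit Defensive.

Import Order.TTheory GRing.Theory Num.Theory.
Import numFieldNormedType.Exports.

Local Open Scope classical_set_scope.
Local Open Scope ring_scope.

(** * Limits of finite sums, finite products and matrix entries *)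

Lemma cvg_sumr (R : realType) (I : Type) (r : seq I) (P : pred I)
    (f : I -> nat -> R) (a : I -> R) :
  (forall i, P i -> f i @ \oo --> a i) ->
  (fun m => \sum_(i <- r | P i) f i m) @ \oo --> \sum_(i <- r | P i) a i.
Proof. by move=> fa; apply: cvg_big => //; exact: add_continuous. Qed.

Lemma cvg_prodr (R : realType) (I : Type) (r : seq I) (P : pred I)
    (f : I -> nat -> R) (a : I -> R) :
  (forall i, P i -> f i @ \oo --> a i) ->
  (fun m => \prod_(i <- r | P i) f i m) @ \oo --> \prod_(i <- r | P i) a i.
Proof. by move=> fa; apply: cvg_big => //; exact: mul_continuous. Qed.

Lemma cvg_mx_coord (R : realType) (p q : nat) (A_ : nat -> 'M[R]_(p, q))
    (A : 'M[R]_(p, q)) (i : 'I_p) (j : 'I_q) :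
  A_ @ \oo --> A -> (fun m => A_ m i j) @ \oo --> A i j.
Proof.
move=> cA; have cc : {for A, continuous (fun B : 'M[R]_(p, q) => B i j)}.
  exact: coord_continuous.
exact: (continuous_cvg _ cc cA).
Qed.

Lemma cvg_mulmx_coord (R : realType) (p q r : nat) (A_ : nat -> 'M[R]_(p, q))
    (B_ : nat -> 'M[R]_(q, r)) (A : 'M[R]_(p, q)) (B : 'M[R]_(q, r)) :
  (forall i j, (fun m => A_ m i j) @ \oo --> A i j) ->
  (forall i j, (fun m => B_ m i j) @ \oo --> B i j) ->
  forall i j, (fun m => (A_ m *m B_ m) i j) @ \oo --> (A *m B) i j.
Proof.
move=> cA cB i j; rewrite mxE.
under eq_fun do rewrite mxE.
by apply: cvg_sumr => a _; exact: cvgM.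
Qed.

(** * Limits of eigenvalues and first-order behaviour of eigenvectors *)

Lemma char_poly_conj (R : comNzRingType) (n : nat) (P Q A : 'M[R]_n) :
  P *m Q = 1%:M -> char_poly (P *m A *m Q) = char_poly A.
Proof.
move=> PQ; rewrite /char_poly /char_poly_mx.
have PQ' : map_mx polyC P *m map_mx polyC Q = 1%:M by rewrite -map_mxM PQ map_mx1.
have -> : 'X%:M - map_mx polyC (P *m A *m Q)
    = map_mx polyC P *m ('X%:M - map_mx polyC A) *m map_mx polyC Q.
  rewrite mulmxBr mulmxBl !map_mxM; congr (_ - _).
  by rewrite scalar_mxC -mulmxA PQ' mulmx1.
by rewrite !det_mulmx mulrAC -det_mulmx PQ' det1 mul1r.
Qed.

Lemma orthogonal_mxC (R : realType) (n : nat) (U : 'M[R]_n) :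
  orthogonal_mx U -> U^T *m U = 1%:M.
Proof. exact: mulmx1C. Qed.

Lemma char_poly_diag (R : comNzRingType) (n : nat) (d : 'rV[R]_n) :
  char_poly (diag_mx d) = \prod_(i < n) ('X - (d ord0 i)%:P).
Proof.
rewrite char_poly_trig ?diag_mx_is_trig //.
by apply: eq_bigr => i _; rewrite mxE eqxx mulr1n.
Qed.

(* The limit of the diagonalized matrices is a diagonal matrix similar to
   [diag_mx mu] with nonincreasing diagonal, hence equal to [diag_mx mu]. *)
Lemma cvg_lambda_diag (R : realType) (n : nat) (mu : 'rV[R]_n)
    (M_ U_ : nat -> 'M[R]_n) (U : 'M[R]_n) :
  nonincreasing_rv mu ->
  (forall m, (M_ m)^T = M_ m) ->
  M_ @ \oo --> (0 : 'M[R]_n) ->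
  (forall m, orthogonal_mx (U_ m)) -> orthogonal_mx U ->
  U_ @ \oo --> U ->
  (forall m, diag_mx mu + M_ m
     = U_ m *m diag_mx (lambda (diag_mx mu + M_ m)) *m (U_ m)^T) ->
  (forall i, (fun m => lambda (diag_mx mu + M_ m) ord0 i) @ \oo --> mu ord0 i)
  /\ U^T *m diag_mx mu *m U = diag_mx mu.
Proof.
move=> mu_noninc M_sym M_cvg0 U_orth Uorth U_cvg U_diag.
pose L m := lambda (diag_mx mu + M_ m).
(* Solved for [L m], the diagonalization expresses the eigenvalues through convergent matrices. *)
have dL m : (U_ m)^T *m (diag_mx mu + M_ m) *m U_ m = diag_mx (L m).
  rewrite U_diag !mulmxA orthogonal_mxC // mul1mx -mulmxA.
  by rewrite orthogonal_mxC // mulmx1.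
have cL i j : (fun m => diag_mx (L m) i j) @ \oo
    --> (U^T *m diag_mx mu *m U) i j.
  under eq_fun do rewrite -dL.
  apply: cvg_mulmx_coord => [i' j'|i' j']; last exact: cvg_mx_coord.
  apply: (@cvg_mulmx_coord _ _ _ _ (fun m => (U_ m)^T)
    (fun m => diag_mx mu + M_ m)) => {i j i' j'} i j.
    rewrite mxE; under eq_fun do rewrite mxE; exact: cvg_mx_coord.
  rewrite -[X in _ --> X]addr0.
  under eq_fun do rewrite mxE.
  apply: cvgD; first exact: cvg_cst.
  by have := @cvg_mx_coord _ _ _ _ _ i j M_cvg0; rewrite mxE.
pose nu := \row_i (U^T *m diag_mx mu *m U) i i.
have cnu i : (fun m => L m ord0 i) @ \oo --> nu ord0 i.
  rewrite mxE; have := cL i i.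
  by under eq_fun do rewrite mxE eqxx mulr1n.
have dnu : U^T *m diag_mx mu *m U = diag_mx nu.
  apply/matrixP => i j; have := cL i j.
  rewrite [in RHS]mxE; have [<-|ij] := eqVneq i j => cij; first by rewrite mulr1n [nu _ _]mxE.
  rewrite mulr0n; apply: (cvg_unique (@norm_hausdorff _ _) cij) => /=.
  under eq_fun do rewrite mxE (negbTE ij) mulr0n.
  exact: cvg_cst.
suff E : nu = mu.
  by split; [move=> i; have := cnu i; rewrite E|rewrite dnu E].
apply: (@is_spectrum_inj _ _ (diag_mx mu)); last by split=> //; exact: char_poly_diag.
split.
  move=> i j ij; apply: (ler_cvg_to (cnu j) (cnu i)).
  apply: nearW => m; apply: (proj1 (@lambdaP _ _ (diag_mx mu + M_ m) _)) => //.
  by rewrite linearD /= M_sym tr_diag_mx.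
by rewrite -char_poly_diag -dnu char_poly_conj //; exact: orthogonal_mxC.
Qed.

(** [U] commutes with [diag_mx mu]; comparing entries gives [(mu_i - mu_j) * U_ij = 0]. *)
Lemma conj_diag_eq0 (R : realType) (n : nat) (mu : 'rV[R]_n) (U : 'M[R]_n)
    (i j : 'I_n) :
  orthogonal_mx U -> U^T *m diag_mx mu *m U = diag_mx mu ->
  ~~ mu_equiv mu i j -> U i j = 0.
Proof.
move=> Uo /(congr1 (mulmx U)); rewrite !mulmxA Uo mul1mx.
move/matrixP/(_ i j); rewrite mul_diag_mx mul_mx_diag !mxE => E.
rewrite /mu_equiv => nij; apply/eqP.
have : (mu ord0 i - mu ord0 j) * U i j = 0 by rewrite mulrBl E [_ * mu _ _]mulrC subrr.
by move/eqP; rewrite mulf_eq0 subr_eq0 (negbTE nij).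
Qed.

(* Off the blocks the eigenvector equation [(mu_i - lambda_a) U_ia = - (M U)_ia]
   determines [U_ia] to first order. *)
Lemma cvg_offblock (R : realType) (n : nat) (mu : 'rV[R]_n) (c : nat -> R)
    (M_ U_ : nat -> 'M[R]_n) (L : nat -> 'rV[R]_n) (M U : 'M[R]_n) :
  (fun m => c m *: M_ m) @ \oo --> M ->
  U_ @ \oo --> U ->
  (forall m, (diag_mx mu + M_ m) *m U_ m = U_ m *m diag_mx (L m)) ->
  (forall i, (fun m => L m ord0 i) @ \oo --> mu ord0 i) ->
  forall i a, ~~ mu_equiv mu i a ->
  (fun m => c m * U_ m i a) @ \oo
    --> - (M *m U) i a / (mu ord0 i - mu ord0 a).
Proof.
move=> Mc Uc eig Lc i a nia.
have d0 : mu ord0 i - mu ord0 a != 0 by rewrite subr_eq0.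
have dc : (fun m => mu ord0 i - L m ord0 a) @ \oo --> mu ord0 i - mu ord0 a.
  by apply: cvgB => //; exact: cvg_cst.
have E m : (mu ord0 i - L m ord0 a) * (c m * U_ m i a) = - ((c m *: M_ m) *m U_ m) i a.
  have /matrixP/(_ i a) := eig m.
  rewrite mulmxDl mul_diag_mx mul_mx_diag -scalemxAl !mxE => e.
  rewrite mulrCA mulrBl [L _ _ _ * _]mulrC -e opprD addrA subrr sub0r.
  by rewrite mulrN.
(* The factor [mu_i - L_a] has a nonzero limit, so it can be divided out for all large [m], which
   suffices for the limit. *)
apply: (cvg_trans _ (_ : (fun m => - ((c m *: M_ m) *m U_ m) i a
    * (mu ord0 i - L m ord0 a)^-1) @ \oo --> _)).
  apply: near_eq_cvg; near=> m.
  rewrite -E mulrAC divff ?mul1r //.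
  by near: m; exact: (cvgr_neq0 _ dc).
apply: cvgM; last exact: cvgV.
apply: cvgN; apply: cvg_mulmx_coord => ? ?; exact: cvg_mx_coord.
Unshelve. all: by end_near.
Qed.

(** Row orthogonality of [U_ m] absorbs [f i *+ (i == j)] into the sum, turning [f a] into
    [f a - f i]. This kills every [a] in the block of [i], so only entries covered by [cvg_offblock]
    remain. *)
Lemma cvg_block_function (R : realType) (n : nat) (mu : 'rV[R]_n) (c : nat -> R)
    (M_ U_ : nat -> 'M[R]_n) (L : nat -> 'rV[R]_n) (M U : 'M[R]_n)
    (f : 'I_n -> R) :
  (fun m => c m *: M_ m) @ \oo --> M ->
  U_ @ \oo --> U ->
  (forall m, orthogonal_mx (U_ m)) -> orthogonal_mx U ->
  (forall m, (diag_mx mu + M_ m) *m U_ m = U_ m *m diag_mx (L m)) ->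
  (forall i, (fun m => L m ord0 i) @ \oo --> mu ord0 i) ->
  (forall i a, ~~ mu_equiv mu i a -> U i a = 0) ->
  (forall i a, mu_equiv mu i a -> f i = f a) ->
  forall i j,
  (fun m => c m * (\sum_a U_ m i a * f a * U_ m j a - f i *+ (i == j))) @ \oo
    --> (f i - f j) * (mx_out mu M i j / (mu ord0 i - mu ord0 j)).
Proof.
move=> Mc Uc Uo_ Uo eig Lc U0 fB i j.
have E m : c m * (\sum_a U_ m i a * f a * U_ m j a - f i *+ (i == j))
    = \sum_a (c m * U_ m i a) * ((f a - f i) * U_ m j a).
  have /matrixP/(_ i j) := Uo_ m; rewrite !mxE => e.
  rewrite -mulr_natr -e mulr_sumr -sumrB mulr_sumr; apply: eq_bigr => a _.
  by rewrite mxE !mulrBl !mulrBr -!mulrA; congr (_ - _); rewrite [f i * _]mulrCA.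
under eq_fun do rewrite E.
(* The right side is the termwise limit. If [i] and [j] share a block, every term vanishes.
   Otherwise only [a] in the block of [j] contributes, where [f] and [mu] take their values at [j],
   and [M = (M *m U) *m U^T] sums these terms. *)
have -> : (f i - f j) * (mx_out mu M i j / (mu ord0 i - mu ord0 j)) =
   \sum_a (if mu_equiv mu i a then 0 else
     (- (M *m U) i a / (mu ord0 i - mu ord0 a)) * ((f a - f i) * U j a)).
  rewrite mxE; case: ifP => ij.
    rewrite mul0r mulr0 big1 // => a _; case: ifPn => // ia.
    rewrite (U0 j a) ?mulr0 //; apply: contra ia; rewrite /mu_equiv in ij *.
    by rewrite (eqP ij).
  have eM : M i j = \sum_a (M *m U) i a * U j a.
    rewrite -[in LHS](mulmx1 M) -Uo mulmxA mxE; apply: eq_bigr => a _.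
    by rewrite [U^T _ _]mxE.
  rewrite eM mulr_suml mulr_sumr; apply: eq_bigr => a _.
  have [ja|ja] := boolP (mu_equiv mu j a).
    have -> : mu_equiv mu i a = false.
      by apply/negP; rewrite /mu_equiv -(eqP ja) -/(mu_equiv _ _ _) ij.
    rewrite -(fB _ _ ja) -(eqP ja).
    by move: ((mu ord0 i - mu ord0 j)^-1) => x; ring.
  by rewrite (U0 _ _ ja) !mulr0 mul0r mulr0; case: ifP.
apply: cvg_sumr => a _; case: ifPn => ia.
  under eq_fun do rewrite (fB _ _ ia) subrr mul0r mulr0.
  exact: cvg_cst.
apply: cvgM; first by apply: cvg_offblock ia; eassumption.
by apply: cvgMl_tmp; exact: cvg_mx_coord.
Qed.

(** * Product rule and expansion of block-constant tensors *)

Lemma cvg_prod_deriv_seq (R : realType) (I : eqType) (r : seq I) (c : nat -> R)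
    (A : I -> nat -> R) (a d : I -> R) :
  uniq r ->
  (forall s, A s @ \oo --> a s) ->
  (forall s, (fun m => c m * (A s m - a s)) @ \oo --> d s) ->
  (fun m => c m * (\prod_(s <- r) A s m - \prod_(s <- r) a s)) @ \oo
    --> \sum_(l <- r) d l * \prod_(s <- r | s != l) a s.
Proof.
move=> ur Aa Ad; elim: r ur => [_|x r IH /= /andP[xr ur]].
  rewrite [X in _ --> X]big_nil; under eq_fun do rewrite !big_nil subrr mulr0.
  exact: cvg_cst.
have -> : \sum_(l <- x :: r) d l * \prod_(s <- x :: r | s != l) a s
    = d x * \prod_(s <- r) a s + a x * \sum_(l <- r) d l * \prod_(s <- r | s != l) a s.
  rewrite big_cons big_cons eqxx mulr_sumr; congr (_ * _ + _).
    (* [x] does not occur in [r], so leaving it out changes nothing. *)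
    rewrite [LHS]big_seq_cond [RHS]big_seq; apply: eq_bigl => s.
    by case sr : (s \in r) => //=; apply/negP => /eqP E; rewrite -E sr in xr.
  rewrite [LHS]big_seq [RHS]big_seq; apply: eq_bigr => l lr.
  rewrite big_cons; have -> : x != l by apply: contraNneq xr => ->.
  by rewrite mulrCA.
(* Telescoping: the first term needs only convergence of the remaining product, the second is the
   induction hypothesis. *)
have E m : c m * (\prod_(s <- x :: r) A s m - \prod_(s <- x :: r) a s)
    = c m * (A x m - a x) * \prod_(s <- r) A s m
      + a x * (c m * (\prod_(s <- r) A s m - \prod_(s <- r) a s)).
  by rewrite !big_cons; ring.
under eq_fun do rewrite E.
apply: cvgD; last by apply: cvgMl_tmp; exact: IH.
by apply: cvgM => //; exact: cvg_prodr.
Qed.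

Lemma cvg_prod_deriv (R : realType) (I : finType) (c : nat -> R)
    (A : I -> nat -> R) (a d : I -> R) :
  (forall s, A s @ \oo --> a s) ->
  (forall s, (fun m => c m * (A s m - a s)) @ \oo --> d s) ->
  (fun m => c m * (\prod_s A s m - \prod_s a s)) @ \oo
    --> \sum_l d l * \prod_(s | s != l) a s.
Proof. by move=> Aa Ad; apply: cvg_prod_deriv_seq => //; exact: index_enum_uniq. Qed.

(* The [block_avg mu b] are constant on blocks and sum to 1 over [b]; averaging
   over all [b] avoids choosing a representative of each block. *)
Definition block_avg (R : realType) (n : nat) (mu : 'rV[R]_n) (b a : 'I_n) : R :=
  (mu_equiv mu a b)%:R / #|[pred x | mu_equiv mu x b]|%:R.

Lemma block_avg_equiv (R : realType) (n : nat) (mu : 'rV[R]_n) (b i a : 'I_n) :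
  mu_equiv mu i a -> block_avg mu b i = block_avg mu b a.
Proof. by rewrite /block_avg /mu_equiv => /eqP ->. Qed.

(** Each [b] equivalent to [a] has the same class as [a], so the sum has [N] nonzero terms, each
    equal to [1 / N]. *)
Lemma sum_block_avg (R : realType) (n : nat) (mu : 'rV[R]_n) (a : 'I_n) :
  \sum_b block_avg mu b a = 1.
Proof.
pose N : R := #|[pred x | mu_equiv mu x a]|%:R.
have N0 : N != 0.
  by rewrite pnatr_eq0 -lt0n; apply/card_gt0P; exists a; rewrite inE /mu_equiv.
rewrite (eq_bigr (fun b => (mu_equiv mu b a)%:R / N)) => [|b _].
  rewrite -mulr_suml -natr_sum -[RHS](divff N0); congr (_ / _); rewrite /N; congr (_%:R).
  rewrite -sum1_card [RHS]big_mkcond /=; apply: eq_bigr => b _.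
  by rewrite inE; case: mu_equiv.
rewrite /block_avg [mu_equiv mu a b]eq_sym -/(mu_equiv mu b a).
case ba : (mu_equiv mu b a); last by rewrite !mul0r.
congr (_ / _%:R); apply: eq_card => x; rewrite !inE /mu_equiv.
by rewrite (eqP ba).
Qed.

(** The value 1 is inserted as a product over the slots of the sums of [block_avg] and expanded by
    distributivity. A multi-index [b] has nonzero weight only if it is slotwise equivalent to [p],
    and then [T b = T p]. *)
Lemma block_constant_avg (R : realType) (n k : nat) (mu : 'rV[R]_n)
    (T : tensor R n k) (p : multi_index n k) : block_constant mu T ->
  T p = \sum_(b : multi_index n k) T b * \prod_s block_avg mu (b s) (p s).
Proof.
move=> Tbc; rewrite -[LHS]mulr1.
have E1 : \prod_(s < k) \sum_b block_avg mu b (p s) = 1.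
  by rewrite big1 // => s _; exact: sum_block_avg.
rewrite -[X in _ * X = _]E1 bigA_distr_bigA mulr_sumr; apply: eq_bigr => b _.
have [/forallP pb|/forallPn[s ns]] := boolP [forall s, mu_equiv mu (p s) (b s)].
  by rewrite (Tbc p b pb).
suff -> : \prod_(s < k) block_avg mu (b s) (p s) = 0 by rewrite !mulr0.
by apply/eqP/prodf_eq0; exists s => //; rewrite /block_avg (negbTE ns) mul0r.
Qed.

Lemma tdiag_avg (R : realType) (n k : nat) (mu : 'rV[R]_n) (sigma : 'S_k)
    (T : tensor R n k) (i j : multi_index n k) : block_constant mu T ->
  tdiag sigma T (i, j) = \sum_(b : multi_index n k) T b *
    \prod_s (block_avg mu (b s) (i s) *+ (i s == j (sigma s))).
Proof.
move=> Tbc; rewrite ffunE /=; case: ifPn => [/forallP ij|/forallPn[s ns]].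
  rewrite (block_constant_avg _ Tbc); apply: eq_bigr => b _; congr (_ * _).
  by apply: eq_bigr => s _; rewrite ij.
rewrite big1 // => b _; apply/eqP; rewrite mulf_eq0; apply/orP; right.
by apply/prodf_eq0; exists s => //; rewrite (negbTE ns) mulr0n.
Qed.

(** Given [p], the support of [tdiag] leaves only [q0], that is [p] composed with the inverse of
    [sigma]. *)
Lemma tconj_tdiag (R : realType) (n k : nat) (U : 'M[R]_n) (sigma : 'S_k)
    (T : tensor R n k) (i j : multi_index n k) :
  tconj U (tdiag sigma T) (i, j) =
  \sum_(p : multi_index n k) T p * \prod_s (U (i s) (p s) * U (j (sigma s)) (p s)).
Proof.
rewrite ffunE; apply: eq_bigr => p _ /=.
pose q0 : multi_index n k := [ffun s => p ((sigma^-1)%g s)].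
rewrite (bigD1 q0) //= [X in _ + X]big1 ?addr0 => [|q nq].
  rewrite ffunE /= ifT; last by apply/forallP => s; rewrite ffunE permK.
  rewrite !big_split /=; congr (_ * (_ * _)).
  rewrite (reindex_inj (@perm_inj _ sigma)) /=; apply: eq_bigr => s _.
  by rewrite ffunE permK.
rewrite ffunE /= ifF ?mul0r //; apply: contraNF nq => /forallP pq.
by apply/eqP/ffunP => s; rewrite ffunE (eqP (pq _)) permKV.
Qed.

(** For each [b], the sum over [p] factors by distributivity into one sum per slot, each an entry of
    a diagonal matrix conjugated by [U]. *)
Lemma tconj_tdiag_avg (R : realType) (n k : nat) (mu : 'rV[R]_n) (U : 'M[R]_n)
    (sigma : 'S_k) (T : tensor R n k) (i j : multi_index n k) :
  block_constant mu T ->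
  tconj U (tdiag sigma T) (i, j) = \sum_(b : multi_index n k) T b *
    \prod_s (\sum_a U (i s) a * block_avg mu (b s) a * U (j (sigma s)) a).
Proof.
move=> Tbc; rewrite tconj_tdiag.
under eq_bigr => p _ do rewrite (block_constant_avg _ Tbc) mulr_suml.
rewrite exchange_big /=; apply: eq_bigr => b _.
rewrite bigA_distr_bigA mulr_sumr; apply: eq_bigr => p _.
rewrite -mulrA -big_split /=; congr (_ * _); apply: eq_bigr => s _.
by rewrite mulrCA mulrA.
Qed.

(** * First-order change of the conjugated tensor *)

(** The [l]-th term of the product rule: slot [l] carries the first-order change found for block
    functions, and the other slots keep the support condition of [tdiag]. Where the denominator
    vanishes, so does [mx_out]. *)
Definition tdiag_deriv (R : realType) (n k : nat) (mu : 'rV[R]_n) (K : 'M[R]_n)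
    (sigma : 'S_k) (T : tensor R n k) (l : 'I_k) (i j : multi_index n k) : R :=
  (T i - T (mi_set i l (j (sigma l))))
    * (mx_out mu K (i l) (j (sigma l)) / (mu ord0 (i l) - mu ord0 (j (sigma l))))
    *+ [forall s, (s != l) ==> (i s == j (sigma s))].

(** The factor of slot [l] is evaluated at [x], so [block_constant_avg] at [mi_set i l x] resums the
    expression; if another slot violates the support condition, each product has a zero factor. *)
Lemma sum_avg_mi_set (R : realType) (n k : nat) (mu : 'rV[R]_n)
    (sigma : 'S_k) (T : tensor R n k) (i j : multi_index n k) (l : 'I_k) (x : 'I_n) :
  block_constant mu T ->
  \sum_(b : multi_index n k) T b * (block_avg mu (b l) x *
    \prod_(s | s != l) (block_avg mu (b s) (i s) *+ (i s == j (sigma s))))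
  = T (mi_set i l x) *+ [forall s, (s != l) ==> (i s == j (sigma s))].
Proof.
move=> Tbc; case: (boolP [forall _, _]) => [/forallP ij|/forallPn[s]].
  rewrite mulr1n [RHS](block_constant_avg _ Tbc); apply: eq_bigr => b _.
  congr (_ * _); rewrite [RHS](bigD1 l) //= ffunE eqxx; congr (_ * _).
  apply: eq_bigr => s sl; rewrite ffunE (negbTE sl).
  by have := ij s; rewrite sl /= => ->.
rewrite negb_imply => /andP[sl ns]; rewrite mulr0n big1 // => b _.
by rewrite (bigD1 s) //= (negbTE ns) mulr0n mul0r !mulr0.
Qed.

Lemma cvg_tconj_tdiag (R : realType) (n k : nat) (mu : 'rV[R]_n) (c : nat -> R)
    (M_ U_ : nat -> 'M[R]_n) (L : nat -> 'rV[R]_n) (M U : 'M[R]_n)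
    (sigma : 'S_k) (T : tensor R n k) :
  (fun m => c m *: M_ m) @ \oo --> M ->
  U_ @ \oo --> U ->
  (forall m, orthogonal_mx (U_ m)) -> orthogonal_mx U ->
  (forall m, (diag_mx mu + M_ m) *m U_ m = U_ m *m diag_mx (L m)) ->
  (forall i, (fun m => L m ord0 i) @ \oo --> mu ord0 i) ->
  (forall i a, ~~ mu_equiv mu i a -> U i a = 0) ->
  block_constant mu T -> forall i j : multi_index n k,
  (fun m => c m * (tconj (U_ m) (tdiag sigma T) (i, j) - tdiag sigma T (i, j)))
    @ \oo --> \sum_l tdiag_deriv mu M sigma T l i j.
Proof.
move=> Mc Uc Uo_ Uo eig Lc U0 Tbc i j.
pose A (b : multi_index n k) s m :=
  \sum_a U_ m (i s) a * block_avg mu (b s) a * U_ m (j (sigma s)) a.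
pose a (b : multi_index n k) s :=
  block_avg mu (b s) (i s) *+ (i s == j (sigma s)).
pose K s := mx_out mu M (i s) (j (sigma s)) / (mu ord0 (i s) - mu ord0 (j (sigma s))).
pose d (b : multi_index n k) s :=
  (block_avg mu (b s) (i s) - block_avg mu (b s) (j (sigma s))) * K s.
have cA b s : A b s @ \oo --> a b s.
  (* [U] vanishes off the blocks, so [block_avg] leaves the sum with its value at [i s], and
     orthogonality of [U] evaluates what remains. *)
  have -> : a b s = \sum_a U (i s) a * block_avg mu (b s) a * U (j (sigma s)) a.
    have /matrixP/(_ (i s) (j (sigma s))) := Uo; rewrite !mxE => e.
    rewrite /a -mulr_natr -e mulr_sumr; apply: eq_bigr => x _; rewrite mxE.
    have [/(block_avg_equiv (b s)) ->|/U0 ->] := boolP (mu_equiv mu (i s) x).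
      by rewrite mulrCA mulrA.
    by rewrite !mul0r mulr0.
  apply: cvg_sumr => x _; apply: cvgM; last exact: cvg_mx_coord.
  by apply: cvgMr_tmp; exact: cvg_mx_coord.
have cd b s : (fun m => c m * (A b s m - a b s)) @ \oo --> d b s.
  apply: cvg_block_function; try eassumption.
  by move=> x y; exact: block_avg_equiv.
(* Both expansions carry the same coefficients [T b], which reduces the limit to the product rule
   for each [b]. *)
have E m : c m * (tconj (U_ m) (tdiag sigma T) (i, j) - tdiag sigma T (i, j))
    = \sum_(b : multi_index n k) T b * (c m * (\prod_s A b s m - \prod_s a b s)).
  rewrite (tconj_tdiag_avg _ _ _ _ Tbc) (tdiag_avg _ _ _ Tbc).
  by rewrite -sumrB mulr_sumr; apply: eq_bigr => b _; rewrite -mulrBr mulrCA.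
under eq_fun do rewrite E.
have -> : \sum_l tdiag_deriv mu M sigma T l i j
    = \sum_(b : multi_index n k) T b * \sum_l d b l * \prod_(s | s != l) a b s.
  under [RHS]eq_bigr do rewrite mulr_sumr.
  rewrite exchange_big /=; apply: eq_bigr => l _.
  (* Writing [T i] as [T (mi_set i l (i l))] lets [sum_avg_mi_set] resum both values of [T], at
     [x = i l] and [x = j (sigma l)]. *)
  have iil : mi_set i l (i l) = i.
    by apply/ffunP => s; rewrite ffunE; case: eqP => // ->.
  rewrite /tdiag_deriv -/(K l) -{1}iil -mulrnAl mulrnBl.
  rewrite -!(sum_avg_mi_set _ _ _ _ _ Tbc) -sumrB mulr_suml.
  by apply: eq_bigr => b _; rewrite /d /a; ring.
by apply: cvg_sumr => b _; apply: cvgMl_tmp; exact: cvg_prod_deriv.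
Qed.

(** * Contraction of the outer tensors with the last matrix *)

Definition mi_rcons (n k : nat) (p : multi_index n k) (a : 'I_n) :
    multi_index n k.+1 :=
  [ffun s => if unlift ord_max s is Some s' then p s' else a].

Lemma mi_rcons_lift (n k : nat) (p : multi_index n k) (a : 'I_n) (s : 'I_k) :
  mi_rcons p a (lift ord_max s) = p s.
Proof. by rewrite ffunE liftK. Qed.

Lemma mi_rcons_max (n k : nat) (p : multi_index n k) (a : 'I_n) :
  mi_rcons p a ord_max = a.
Proof. by rewrite ffunE unlift_none. Qed.

Lemma mi_rconsK (n k : nat) (p : multi_index n k) (a : 'I_n) :
  mi_init (mi_rcons p a) = p.
Proof. by apply/ffunP => s; rewrite ffunE mi_rcons_lift. Qed.

Lemma sum_mi_rcons (R : realType) (n k : nat) (F : multi_index n k.+1 -> R) :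
  \sum_p F p = \sum_p \sum_a F (mi_rcons p a).
Proof.
rewrite pair_big /= (reindex (fun pa => mi_rcons pa.1 pa.2)) //=.
exists (fun p => (mi_init p, p ord_max)) => [[p a] _|p _] /=.
  by rewrite mi_rconsK mi_rcons_max.
apply/ffunP => s; rewrite ffunE; case: unliftP => [s' ->|->] //.
by rewrite ffunE.
Qed.

(** The three conditions come from the last position, from position [l] and from the other
    positions. *)
Lemma forall_perm_ext (n k : nat) (sigma : 'S_k) (l : 'I_k)
    (p q : multi_index n k) (a b : 'I_n) :
  [forall s, mi_rcons p a s == mi_rcons q b (perm_ext sigma l s)] =
  [&& a == q (sigma l), b == p l & [forall s, (s != l) ==> (p s == q (sigma s))]].
Proof.
apply/forallP/and3P => [pq|[/eqP-> /eqP-> /forallP pq] s].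
  split.
  - by have := pq ord_max; rewrite perm_ext_max mi_rcons_lift mi_rcons_max.
  - by have := pq (lift ord_max l); rewrite perm_ext_l mi_rcons_lift mi_rcons_max eq_sym.
  - apply/forallP => s; apply/implyP => sl.
    by have := pq (lift ord_max s); rewrite perm_ext_neq // !mi_rcons_lift.
case: (unliftP ord_max s) => [s' ->|->]; last first.
  by rewrite perm_ext_max mi_rcons_lift mi_rcons_max.
have [->|sl] := eqVneq s' l; first by rewrite perm_ext_l mi_rcons_lift mi_rcons_max.
by rewrite perm_ext_neq // !mi_rcons_lift; have := pq s'; rewrite sl.
Qed.

(** The support of [tdiag] forces the last pair of indices to be [(q (sigma l), p l)], so the last
    matrix is read at this entry. Symmetry of [K] swaps the two indices to match [tdiag_deriv]. *)
Lemma tapply_tensor_out (R : realType) (n k : nat) (mu : 'rV[R]_n) (K : 'M[R]_n)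
    (sigma : 'S_k) (T : tensor R n k) (H : 'I_k -> 'M[R]_n) (l : 'I_k) :
  K^T = K ->
  tapply (tdiag (perm_ext sigma l) (tensor_out mu l T)) (mxs_rcons H (mx_out mu K))
  = \sum_(p : multi_index n k) \sum_(q : multi_index n k)
      tdiag_deriv mu K sigma T l p q * \prod_(s < k) H s (p s) (q s).
Proof.
move=> Ksym; rewrite /tapply sum_mi_rcons; apply: eq_bigr => p _.
under eq_bigr do rewrite sum_mi_rcons.
rewrite exchange_big /=; apply: eq_bigr => q _.
rewrite (bigD1 (q (sigma l))) //= [X in _ + X]big1 ?addr0 => [|a na]; last first.
  apply: big1 => b _.
  by rewrite ffunE /= forall_perm_ext (negbTE na) mul0r.
rewrite (bigD1 (p l)) //= [X in _ + X]big1 ?addr0 => [|b nb]; last first.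
  by rewrite ffunE /= forall_perm_ext (negbTE nb) andbF mul0r.
rewrite ffunE /= forall_perm_ext !eqxx /= /tdiag_deriv.
case: [forall _, _]; last by rewrite mulr0n !mul0r.
rewrite mulr1n (bigD1_ord ord_max) //= /mxs_rcons unlift_none !mi_rcons_max.
under eq_bigr do rewrite liftK !mi_rcons_lift.
rewrite [LHS]mulrA; congr (_ * _).
rewrite ffunE /= !mi_rcons_lift !mi_rcons_max mi_rconsK !mxE.
have -> : K (q (sigma l)) (p l) = K (p l) (q (sigma l)) by rewrite -[in LHS]Ksym mxE.
(* On equivalent indices both sides are 0; otherwise numerator and denominator both change sign. *)
rewrite /mu_equiv [mu _ (q _) == _]eq_sym; case: ifP => _; first by rewrite !mul0r mulr0.
by rewrite -[_ - mu ord0 (p l)]opprB invrN; ring.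
Qed.

Theorem theorem5p1 (R : realType) (n : nat) (mu : 'rV[R]_n)
  (mu_noninc : nonincreasing_rv mu)
  (M_ : nat -> 'M[R]_n) (M : 'M[R]_n)
  (M_sym : forall m, (M_ m)^T = M_ m)
  (M_neq0 : forall m, M_ m != 0)
  (M_cvg0 : M_ @ \oo --> (0 : 'M[R]_n))
  (M_dir : (fun m => (fnorm (M_ m))^-1 *: M_ m) @ \oo --> M)
  (U_ : nat -> 'M[R]_n) (U : 'M[R]_n)
  (U_orth : forall m, orthogonal_mx (U_ m))
  (Ulim_orth : orthogonal_mx U)
  (U_cvg : U_ @ \oo --> U)
  (U_diag : forall m,
     diag_mx mu + M_ m
     = U_ m *m diag_mx (lambda (diag_mx mu + M_ m)) *m (U_ m)^T)
  (k : nat) (T : tensor R n k) (T_bc : block_constant mu T)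
  (H : 'I_k -> 'M[R]_n) (sigma : 'S_k) :
  (fun m => tapply ((fnorm (M_ m))^-1 *:
                      (tconj (U_ m) (tdiag sigma T) - tdiag sigma T)) H) @ \oo
  --> \sum_(l < k) tapply (tdiag (perm_ext sigma l) (tensor_out mu l T))
                          (mxs_rcons H (mx_out mu M)).
Proof.
pose c m := (fnorm (M_ m))^-1.
have [Lc dU] := cvg_lambda_diag mu_noninc M_sym M_cvg0 U_orth Ulim_orth U_cvg U_diag.
(* [tapply_tensor_out] requires a symmetric matrix; symmetry passes to [M] by uniqueness of the
   limits of entries. *)
have Msym : M^T = M.
  apply/matrixP => i j; rewrite mxE.
  have symE m : (c m *: M_ m) j i = (c m *: M_ m) i j.
    by rewrite !mxE -[in LHS]M_sym mxE.
  apply: (cvg_unique (@norm_hausdorff _ _) (cvg_mx_coord (i:=j) (j:=i) M_dir)) => /=.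
  under eq_fun do rewrite symE.
  exact: cvg_mx_coord.
have eig m : (diag_mx mu + M_ m) *m U_ m = U_ m *m diag_mx (lambda (diag_mx mu + M_ m)).
  by rewrite {1}U_diag -mulmxA orthogonal_mxC // mulmx1.
(* Both sides become sums over [p] and [q] with the same products of entries of [H], so the limit of
   each tensor entry suffices. *)
rewrite [X in _ --> X](_ : _ = \sum_(p : multi_index n k) \sum_(q : multi_index n k)
    (\sum_l tdiag_deriv mu M sigma T l p q) * \prod_(s < k) H s (p s) (q s)).
  2: {
    under eq_bigr do rewrite tapply_tensor_out //.
    rewrite exchange_big /=; apply: eq_bigr => p _.
    by rewrite exchange_big /=; apply: eq_bigr => q _; rewrite -mulr_suml.
  }
apply: cvg_sumr => p _; apply: cvg_sumr => q _.
apply: cvgMr_tmp.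
have E m : (c m *: (tconj (U_ m) (tdiag sigma T) - tdiag sigma T)) (p, q)
    = c m * (tconj (U_ m) (tdiag sigma T) (p, q) - tdiag sigma T (p, q)).
  by rewrite !ffunE.
under eq_fun do rewrite E.
apply: (@cvg_tconj_tdiag _ _ _ _ _ M_ U_ (fun m => lambda (diag_mx mu + M_ m)) M U) => //.
by move=> i a; exact: conj_diag_eq0.
Qed.
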